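(* Let $\mathbf F^k$ be the $k$-dimensional vector space over a finite field $\mathbf F$ (with $k\in\mathbb N$) and let $\mathbf B$ be a faithful $\mathbf R$-module such that $|F|$ is invertible in $\mathbf R$. Then every clonoid $\mathcal C$ from $\mathbf F^k$ to $\mathbf B$ is generated by its $k$-ary part, i.e. $\mathcal C=\langle\mathcal C^{(k)}\rangle_{\mathbf F^k,\mathbf B}$.
   Context: $\mathbb N=\{1,2,\dots\}$. Rings are unital, modules are left modules; ''$|F|$ is invertible in $\mathbf R$'' means $|F|\cdot 1_{\mathbf R}$ is a unit. For sets $A,B$, $\mathcal O_{A,B}=\bigcup_{m\ge 1}B^{A^m}$; for $\mathcal C\subseteq\mathcal O_{A,B}$, $\mathcal C^{(m)}=\mathcal C\cap B^{A^m}$. A module over a ring $\mathbf S$ is viewed as an algebra $(A,+,0,-,(s)_{s\in S})$; its $m$-ary term operations are the maps $\sum_{i=1}^ms_ix_i$ with $s_i\in S$. A clonoid from an algebra $\mathbf A$ to an algebra $\mathbf B$ is a set $\mathcal C\subseteq\mathcal O_{A,B}$ such that for all $m,n\in\mathbb N$: (i) if $f_1,\dots,f_n\in\mathcal C^{(m)}$ and $g$ is an $n$-ary term operation of $\mathbf B$, then $g\circ(f_1,\dots,f_n)\in\mathcal C^{(m)}$; (ii) if $f\in\mathcal C^{(m)}$ and $g_1,\dots,g_m$ are $n$-ary term operations of $\mathbf A$, then $f\circ(g_1,\dots,g_m)\in\mathcal C^{(n)}$. For $G\subseteq\mathcal O_{A,B}$, $\langle G\rangle_{\mathbf A,\mathbf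 B}$ is the smallest clonoid from $\mathbf A$ to $\mathbf B$ containing $G$. *)

(* Defs.v *)
From HB Require Import structures.
From mathcomp Require Import all_boot all_order all_algebra.
From mathcomp Require Import boolp classical_sets.

Set Implicit Arguments.
Unset Strict Implicit.
Unset Printing Implicit Defensive.

Import GRing.Theory.

Local Open Scope classical_set_scope.
Local Open Scope ring_scope.

(* Operations of arity m >= 1 from A to B are the maps [op_of m' A B] with
   m = m'.+1, so that nullary operations are excluded by construction. *)
Definition op_of (m : nat) (A B : Type) : Type := ('I_m.+1 -> A) -> B.

Definition finop (A B : Type) : Type := {m : nat & op_of m A B}.

Definition mkop (A B : Type) (m : nat) (f : op_of m A B) : finop A B :=
  existT (fun m => op_of m A B) m f.

Definition arity (A B : Type) (f : finop A B) : nat := (projT1 f).+1.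

Definition ary_part (A B : Type) (k : nat) (C : set (finop A B)) :
    set (finop A B) :=
  [set f | C f /\ arity f = k].

Definition term_op (S : pzRingType) (A : lmodType S) (m : nat)
    (g : op_of m A A) : Prop :=
  exists s : 'I_m.+1 -> S, g = (fun x => \sum_(i < m.+1) s i *: x i).

Definition is_clonoid (S R : pzRingType) (A : lmodType S) (B : lmodType R)
    (C : set (finop A B)) : Prop :=
  (forall (m n : nat) (f : 'I_n.+1 -> op_of m A B) (g : op_of n B B),
     (forall i, C (mkop (f i))) -> term_op g ->
     C (mkop (fun x : 'I_m.+1 -> A => g (fun i => f i x)))) /\
  (forall (m n : nat) (f : op_of m A B) (g : 'I_m.+1 -> op_of n A A),
     C (mkop f) -> (forall i, term_op (g i)) ->
     C (mkop (fun x : 'I_n.+1 -> A => f (fun i => g i x)))).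

Definition clonoid_gen (S R : pzRingType) (A : lmodType S) (B : lmodType R)
    (G : set (finop A B)) : set (finop A B) :=
  smallest (@is_clonoid S R A B) G.

Lemma is_clonoid_gen (S R : pzRingType) (A : lmodType S) (B : lmodType R)
    (G : set (finop A B)) : is_clonoid (clonoid_gen G).
Proof.
split=> m n f g Hf Hg D [cD GD]; case: (cD) => D1 D2.
- by apply: D1 => // i; apply: Hf.
- by apply: D2 => //; apply: Hf.
Qed.

Definition faithful_module (R : pzRingType) (B : lmodType R) : Prop :=
  forall r : R, (forall b : B, r *: b = 0) -> r = 0.

(* [GRing.unit] needs a [unitRingType], which would restrict the ring to be
   nontrivial with a given inverse operation. *)
Definition invertible (R : pzRingType) (x : R) : Prop :=
  exists y : R, y * x = 1 /\ x * y = 1.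

(* Main.v *)
Require Import Defs.
From HB Require Import structures.
From mathcomp Require Import all_boot all_order all_algebra.
From mathcomp Require Import boolp classical_sets.

Set Implicit Arguments.
Unset Strict Implicit.
Unset Printing Implicit Defensive.

Import GRing.Theory.

Local Open Scope classical_set_scope.
Local Open Scope ring_scope.

(** An m-ary operation on F^k is a function of an m x k matrix, and composing
    it with term operations of F^k is precomposition with left multiplication
    by a matrix over F.  A matrix of rank at most k factors through F^k, so it
    suffices to write every f as an R-combination of functions [f (b *m x)]
    with [\rank b <= k].  This follows from a form of Kovacs' theorem: the
    matrices of rank < r in 'M_m span an ideal of the semigroup algebra having
    a left identity, provided |F| is invertible.

    The left identity is built by induction on m and r.  Suppose f vanishes on
    rank < r, and let U be an r-dimensional subspace of F^m with basis P and
    projection P Q.  Let 1 - w be the element of the semigroup algebra of 'M_r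
    that kills all singular matrices.  Then the average over all a of
    f (P (b Q + a (1 - P Q)) x), summed over b with the coefficients of 1 - w,
    is f x if the columns of x lie in U, and 0 for every other x of rank at
    most r: translating a makes Q x singular.  Summing over all U gives f on
    rank <= r. *)

(* The list [v] of pairs (c, b) encodes the formal sum of the c b. *)
Definition mxact (F : finFieldType) (R : pzRingType) (B : lmodType R)
    (m n l : nat) (v : seq (R * 'M[F]_(m, n))) (f : 'M[F]_(m, l) -> B)
    (x : 'M[F]_(n, l)) : B :=
  \sum_(p <- v) p.1 *: f (p.2 *m x).

(** Matrices act on functions by precomposition, so their factors come in reverse order; the
    coefficients, over a possibly noncommutative [R], keep theirs. *)
Definition mxcomp (F : finFieldType) (R : pzRingType) (m n q : nat)
    (v : seq (R * 'M[F]_(n, q))) (w : seq (R * 'M[F]_(m, n))) :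
    seq (R * 'M[F]_(m, q)) :=
  [seq (p.1 * s.1, s.2 *m p.2) | p <- v, s <- w].

Lemma mxact_cat (F : finFieldType) (R : pzRingType) (B : lmodType R)
    (m n l : nat) (v w : seq (R * 'M[F]_(m, n))) (f : 'M[F]_(m, l) -> B)
    (x : 'M[F]_(n, l)) :
  mxact (v ++ w) f x = mxact v f x + mxact w f x.
Proof. exact: big_cat. Qed.

Lemma mxact_comp (F : finFieldType) (R : pzRingType) (B : lmodType R)
    (m n q l : nat) (v : seq (R * 'M[F]_(n, q))) (w : seq (R * 'M[F]_(m, n)))
    (f : 'M[F]_(m, l) -> B) (x : 'M[F]_(q, l)) :
  mxact (mxcomp v w) f x = mxact v (mxact w f) x.
Proof.
rewrite /mxact big_allpairs_dep; apply: eq_bigr => p _ /=.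
rewrite scaler_sumr; apply: eq_bigr => s _ /=.
by rewrite scalerA mulmxA.
Qed.

Lemma mxactB (F : finFieldType) (R : pzRingType) (B : lmodType R)
    (m n l : nat) (v : seq (R * 'M[F]_(m, n))) (f g : 'M[F]_(m, l) -> B)
    (x : 'M[F]_(n, l)) :
  mxact v (fun y => f y - g y) x = mxact v f x - mxact v g x.
Proof. by rewrite /mxact -sumrB; apply: eq_bigr => p _; rewrite scalerBr. Qed.

Lemma mxact_scale (F : finFieldType) (R : pzRingType) (B : lmodType R)
    (m n l : nat) (c : R) (v : seq (R * 'M[F]_(m, n)))
    (f : 'M[F]_(m, l) -> B) (x : 'M[F]_(n, l)) :
  mxact [seq (c * p.1, p.2) | p <- v] f x = c *: mxact v f x.
Proof.
by rewrite /mxact big_map scaler_sumr; apply: eq_bigr => p _; rewrite scalerA.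
Qed.

Lemma mxrank_factor (F : fieldType) (m n k : nat) (b : 'M[F]_(m, n)) :
  (\rank b <= k)%N ->
  exists P : 'M[F]_(m, k), exists Q : 'M[F]_(k, n), b = P *m Q.
Proof.
move=> hb; exists (col_ebase b *m pid_mx (\rank b)).
exists (pid_mx (\rank b) *m row_ebase b).
rewrite mulmxA -[_ *m pid_mx _ *m pid_mx _]mulmxA mul_pid_mx minnn (minn_idPr hb).
by rewrite mulmx_ebase.
Qed.

(** Column spaces are handled as row spaces of transposes. [choose] picks one basis matrix per
    space; equal ranks turn inclusion into equality, so exactly one basis is counted. *)
Lemma column_space_representatives (F : finFieldType) (m r : nat) :
  exists s : seq 'M[F]_(m, r), all (fun P => \rank P == r) s /\
    forall l (x : 'M[F]_(m, l)), \rank x = r ->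
      count (fun P => (x^T <= P^T)%MS) s = 1%N.
Proof.
pose rep (P : 'M[F]_(m, r)) := choose (fun P' => (P'^T == P^T)%MS) P.
have repE P : ((rep P)^T == P^T)%MS.
  by apply: (@chooseP _ (fun P' => (P'^T == P^T)%MS)); rewrite submx_refl.
have rep_eq P P' : (P^T == P'^T)%MS -> rep P = rep P'.
  move=> /eqmxP e; rewrite /rep.
  rewrite (@eq_choose _ _ (fun P0 => (P0^T == P'^T)%MS)); last first.
    by move=> P0 /=; rewrite !e.
  by apply: choose_id; rewrite ?e submx_refl.
exists [seq P <- enum 'M[F]_(m, r) | (\rank P == r) && (rep P == P)].
split.
  by apply/allP => P; rewrite mem_filter => /andP[/andP[]].
move=> l x hx.
have [P1 [hP1 xP1]] : exists P : 'M[F]_(m, r), \rank P = r /\ (x^T == P^T)%MS.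
  have [P [Q xE]] : exists P : 'M[F]_(m, r), exists Q : 'M[F]_(r, l), x = P *m Q.
    by apply: mxrank_factor; rewrite hx.
  have rP : \rank P = r.
    by apply/eqP; rewrite eqn_leq rank_leq_col -{1}hx xE mxrankM_maxl.
  exists P; split=> //.
  have sub : (x^T <= P^T)%MS by rewrite xE trmx_mul submxMl.
  by rewrite -(mxrank_leqif_eq sub) !mxrank_tr hx rP.
set s := filter _ _.
have us : uniq s by rewrite filter_uniq ?enum_uniq.
have e1 : (x^T :=: (rep P1)^T)%MS.
  by apply: eqmx_trans (eqmxP xP1) (eqmx_sym (eqmxP (repE P1))).
have rs : rep P1 \in s.
  rewrite mem_filter mem_enum andbT (rep_eq _ _ (repE P1)) eqxx andbT.
  by rewrite -mxrank_tr -e1 mxrank_tr hx.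
rewrite (@eq_in_count _ _ (pred1 (rep P1))) ?(count_uniq_mem _ us) ?rs //.
move=> P; rewrite mem_filter /= => /andP[/andP[/eqP rP /eqP repP] _].
apply/idP/eqP => [sub|->]; last by rewrite e1.
rewrite -{1}repP; apply: rep_eq.
have : (x^T == P^T)%MS by rewrite -(mxrank_leqif_eq sub) !mxrank_tr hx rP.
move=> /eqmxP xP; apply/eqmxP; apply: eqmx_trans (eqmx_sym xP) (eqmxP xP1).
Qed.

(** For [P] of full column rank, [pinvmx P] is a left inverse. The sum over [a] is unnormalised; its
    factor [#|F| ^ (r * m)] is divided out in [low_rank_left_identity]. *)
Definition transvection_average (F : finFieldType) (R : pzRingType) (m r : nat)
    (P : 'M[F]_(m, r)) (u : seq (R * 'M[F]_r)) : seq (R * 'M[F]_m) :=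
  [seq (p.1, P *m (p.2 *m pinvmx P + a *m (1%:M - P *m pinvmx P)))
     | a <- enum 'M[F]_(r, m), p <- u].

(** Split the rows of [y] along [z] and a complement of [z] in [x]. Removing the [z] part leaves
    rows in that complement, whose rank is smaller because [z != 0]. *)
Lemma rank_reduce_modulo (F : fieldType) (m n r l : nat) (y : 'M[F]_(r, l))
    (z : 'M[F]_(n, l)) (x : 'M[F]_(m, l)) :
  (y <= x)%MS -> (z <= x)%MS -> z != 0 ->
  exists a : 'M[F]_(r, n), (\rank (y - a *m z)%R < \rank x)%N.
Proof.
move=> yx zx z0.
have : (y <= (x :\: z) + z)%MS.
  apply: submx_trans yx _; rewrite -(addsmx_diff_cap_eq x z).
  exact: addsmxS (submx_refl _) (capmxSr _ _).
case/sub_addsmxP => -[c a] /= ->; exists a; rewrite addrK.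
apply: leq_ltn_trans (mxrankM_maxr _ _) _.
rewrite -(mxrank_cap_compl x z) -[X in (X < _)%N]add0n ltn_add2r.
have /capmx_idPr -> := zx.
by rewrite lt0n mxrank_eq0.
Qed.

Lemma mxact_transvection_average (F : finFieldType) (R : pzRingType)
    (B : lmodType R) (m r l : nat) (P : 'M[F]_(m, r)) (w : seq (R * 'M[F]_r))
    (f : 'M[F]_(m, l) -> B) (x : 'M[F]_(m, l)) :
  \rank P = r -> all (fun p => \rank p.2 < r)%N w ->
  (forall (h : 'M[F]_(r, l) -> B) y, (\rank y < r)%N -> mxact w h y = h y) ->
  (forall y, (\rank y < r)%N -> f y = 0) -> (\rank x <= r)%N ->
  mxact (transvection_average P ((1, 1%:M) :: [seq (- p.1, p.2) | p <- w])) f x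
  = (if (x^T <= P^T)%MS then f x else 0) *+ #|F| ^ (r * m).
Proof.
move=> rP /allP rw idw f0 rx.
rewrite /transvection_average; set Q := pinvmx P; set N := 1%:M - P *m Q.
have QP : Q *m P = 1%:M by apply: mulVpmx; rewrite /row_full rP.
clearbody Q.
have subE : (x^T <= P^T)%MS = (N *m x == 0).
  rewrite mulmxBl mul1mx subr_eq0; apply/idP/eqP => [/submxP[d]|->].
    move/(congr1 trmx); rewrite trmx_mul !trmxK => ->.
    by rewrite -mulmxA [Q *m (_ *m _)]mulmxA QP mul1mx.
  by rewrite -mulmxA trmx_mul submxMl.
have NxE : N *m x = 0 -> P *m (Q *m x) = x.
  by move/eqP; rewrite mulmxBl mul1mx subr_eq0 -mulmxA => /eqP.
clearbody N.
rewrite /mxact big_allpairs_dep big_enum /= subE.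
under eq_bigr => a _ do rewrite big_cons big_map /= scale1r.
have [Nx0|Nx] := eqVneq (N *m x) 0.
  have xE := NxE Nx0.
  rewrite (eq_bigr (fun=> f x)) ?sumr_const ?card_mx // => a _.
  (* For singular [b] the matrix [P *m b *m Q *m x] has rank below [r], so only the identity term
     survives. *)
  rewrite big1_seq ?addr0 => [|p /andP[_ /rw rp]].
    by rewrite mul1mx -mulmxA mulmxDl -mulmxA Nx0 mulmx0 addr0 xE.
  rewrite f0 ?scaler0 // -mulmxA mulmxDl -[a *m _ *m x]mulmxA Nx0 mulmx0 addr0.
  apply: leq_ltn_trans (mxrankM_maxr _ _) _; rewrite -mulmxA.
  exact: leq_ltn_trans (mxrankM_maxl _ _) rp.
rewrite mul0rn.
have [a0 ra0] := rank_reduce_modulo (submxMl Q x) (submxMl N x) Nx.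
set y := _ - _ in ra0; have {ra0} ry := leq_trans ra0 rx.
(* Translating [a] by [b *m a0] replaces [Q *m x] by the singular [y]. *)
have shift (b : 'M[F]_r) : \sum_a f (P *m (b *m Q + a *m N) *m x) =
    \sum_a f (P *m (b *m y + a *m (N *m x))).
  rewrite (reindex_inj (addIr (- (b *m a0)))); apply: eq_bigr => a _.
  congr (f _); rewrite -mulmxA mulmxDl; congr (_ *m _).
  rewrite -[b *m Q *m x]mulmxA -mulmxA mulmxBl /y mulmxBr.
  by rewrite [RHS]addrAC addrA [b *m (a0 *m _)]mulmxA.
rewrite big_split /= shift exchange_big /=.
rewrite (eq_bigr (fun p : R * 'M_r =>
  - \sum_a p.1 *: f (P *m (p.2 *m y + a *m (N *m x))))); last first.
  by move=> p _; rewrite -scaler_sumr -scaler_sumr shift scaleNr.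
rewrite sumrN exchange_big /= -sumrB big1 // => a _.
(* For fixed [a], [w] reproduces this function of [z] at the singular [y], which cancels the
   identity term. *)
have := idw (fun z => f (P *m (z + a *m (N *m x)))) y ry.
by rewrite /mxact mul1mx => ->; rewrite subrr.
Qed.

Lemma invertible_nat_expr (R : pzRingType) (q n : nat) :
  invertible (q%:R : R) -> exists y : R, y * (q ^ n)%:R = 1.
Proof.
case=> y [yq _]; exists (y ^+ n).
by rewrite natrX -exprMn_comm ?yq ?expr1n //; exact: commr_nat.
Qed.

Lemma low_rank_left_identity (F : finFieldType) (R : pzRingType)
    (B : lmodType R) (m r : nat) :
  invertible (#|F|%:R : R) ->
  exists v : seq (R * 'M[F]_m), all (fun p => \rank p.2 < r)%N v /\
    forall l (f : 'M[F]_(m, l) -> B) x, (\rank x < r)%N -> mxact v f x = f x.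
Proof.
move=> hF; elim/ltn_ind: m r => m IHm.
elim=> [|r [v [rv idv]]]; first by exists [::].
have [mr|rm] := leqP m r.
  exists [:: (1, 1%:M)]; split=> [|l f x _]; first by rewrite /= mxrank1 ltnS mr.
  by rewrite /mxact big_seq1 scale1r mul1mx.
have [w [rw idw]] := IHm r rm r.
have [s [rs cs]] := column_space_representatives F m r.
have [y yq] := invertible_nat_expr (r * m) hF.
pose u := (1 : R, 1%:M : 'M[F]_r) :: [seq (- p.1, p.2) | p <- w].
pose e := [seq (y * p.1, p.2)
  | p <- flatten [seq transvection_average P u | P <- s]].
have eP l (f : 'M[F]_(m, l) -> B) x :
    (forall z, (\rank z < r)%N -> f z = 0) -> (\rank x <= r)%N ->
    mxact e f x = f x.
  move=> f0 rx; rewrite mxact_scale {1}/mxact big_flatten big_map /=.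
  rewrite (eq_big_seq (fun P =>
    (if (x^T <= P^T)%MS then f x else 0) *+ #|F| ^ (r * m))); last first.
    move=> P /(allP rs)/eqP rP.
    exact: (mxact_transvection_average rP rw (@idw l) f0 rx).
  rewrite sumrMnl -scaler_nat scalerA yq scale1r -big_mkcond /=.
  (* At rank [r] exactly one representative contributes [f x]; at smaller rank [f x] is already
     0. *)
  rewrite big_const_seq iter_addr_0.
  move: rx; rewrite leq_eqVlt => /orP[/eqP rx|/f0 ->]; first by rewrite cs.
  by rewrite mul0rn.
(* As an operator this is 1 - (1 - e)(1 - v): [f - v f] vanishes below rank [r], so [e] reproduces
   it up to rank [r]. *)
exists (v ++ e ++ [seq (-1 * p.1, p.2) | p <- mxcomp e v]); split.
  rewrite !all_cat; apply/and3P; split.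
  - by apply: sub_all rv => p /ltnW; rewrite ltnS.
  - rewrite all_map; apply/allP => p /flattenP[t /mapP[P _ ->]].
    case/allpairsP => -[a p'] [_ _ ->] /=; rewrite ltnS.
    by apply: leq_trans (mxrankM_maxl _ _) _; exact: rank_leq_col.
  - rewrite all_map; apply/allP => p /allpairsP[[p1 p2] [_ /(allP rv) /= h ->]] /=.
    by apply: leq_ltn_trans (mxrankM_maxl _ _) _; exact: ltnW.
move=> l f x rx; rewrite !mxact_cat (mxact_scale (-1)) mxact_comp scaleN1r.
rewrite -mxactB eP; last exact: rx; first by rewrite addrC subrK.
by move=> z /idv ->; rewrite subrr.
Qed.

Lemma is_clonoid_scale_add (S R : pzRingType) (A : lmodType S) (B : lmodType R)
    (D : set (finop A B)) (m : nat) (f g : op_of m A B) (c : R) :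
  is_clonoid D -> D (mkop f) -> D (mkop g) ->
  D (mkop (fun x => c *: f x + g x : B)).
Proof.
case=> Dl _ Df Dg.
have := Dl m 1%N (fun i => if i == 0 then f else g)
  (fun x => \sum_(i < 2) (if i == 0 then c else 1) *: x i) _ _.
rewrite (_ : (fun x => _) = (fun x => c *: f x + g x)).
  by apply=> [i|]; [case: ifP | exists (fun i => if i == 0 then c else 1)].
by apply: funext => x; rewrite !big_ord_recl big_ord0 /= scale1r addr0.
Qed.

Theorem corollary50 (F : finFieldType) (k : nat) (hk : (0 < k)%N)
    (R : pzRingType) (B : lmodType R)
    (hB : faithful_module B)
    (hF : invertible (#|F|%:R : R))
    (C : set (finop 'rV[F]_k B))
    (hC : is_clonoid C) :
  C = clonoid_gen (ary_part k C).
Proof.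
case: k hk C hC => // k _ C hC.
rewrite eqEsubset; split; last by apply: smallest_sub => // f [].
case=> m f Cf; rewrite -/(mkop f) in Cf *.
set D := clonoid_gen _; have cD : is_clonoid D by exact: is_clonoid_gen.
pose rows n (X : 'M[F]_(n, k.+1)) i := row i X.
have rowsE n p (b : 'M[F]_(n, p)) (x : 'I_p -> 'rV[F]_k.+1) i :
    rows n (b *m \matrix_i x i) i = \sum_j b i j *: x j.
  rewrite /rows row_mul mulmx_sum_row; apply: eq_bigr => j _.
  by rewrite rowK mxE.
have Dlow (b : 'M[F]_m.+1) : (\rank b <= k.+1)%N ->
    D (mkop (fun x : 'I_m.+1 -> 'rV_k.+1 => f (rows _ (b *m \matrix_i x i)))).
  move=> /mxrank_factor[P [Q ->]].
  pose g (z : 'I_k.+1 -> 'rV[F]_k.+1) := f (fun i => \sum_j P i j *: z j).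
  have Dg : D (mkop g).
    apply: sub_gen_smallest; split=> //.
    apply: (hC.2 m k f (fun i z => \sum_j P i j *: z j)) => // i.
    by exists (P i).
  have := cD.2 k m g (fun i x => \sum_j Q i j *: x j) Dg _.
  rewrite (_ : (fun x => g _) =
    (fun x => f (rows _ (P *m Q *m \matrix_i x i)))); last first.
    apply: funext => x; congr f; apply: funext => i.
    rewrite -mulmxA -[Q *m _](_ : \matrix_j (\sum_l Q j l *: x l) = _).
      by rewrite rowsE.
    by apply/row_matrixP => j; rewrite rowK -rowsE.
  by apply=> i; exists (Q i).
(* Matrices with [k.+1] columns have rank below [k.+2], so [idv] applies to every argument. *)
have [v [rv idv]] := low_rank_left_identity B m.+1 k.+2 hF.
have -> : f = (fun x => mxact v (fun X => f (rows _ X)) (\matrix_i x i)).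
  apply: funext => x; rewrite idv ?ltnS ?rank_leq_col //; congr f.
  by apply: funext => i; rewrite /rows rowK.
elim: v rv {idv} => [_|[c b] v IH /= /andP[rb /IH Dv]].
  (* The empty sum needs the zero operation in [D]: it is the difference of a member with itself,
     the member coming from the zero matrix. *)
  have D0 : D (mkop (fun x : 'I_m.+1 -> 'rV_k.+1 => f (rows _ (0 *m \matrix_i x i)))).
    by apply: Dlow; rewrite mxrank0.
  have := is_clonoid_scale_add (-1) cD D0 D0; congr (D (mkop _)).
  by apply: funext => x; rewrite /mxact big_nil scaleN1r addNr.
have := is_clonoid_scale_add c cD (Dlow b rb) Dv; congr (D (mkop _)).
by apply: funext => x; rewrite /mxact big_cons.
Qed.
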